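(* Let $P=\{p_1,\dots,p_n\}$ be weighted points in $\mathbb{R}^2$ with total weight $1$, let $S=\{s_1,\dots,s_m\}$ be line segments in $\mathbb{R}^2$ of total length $1$, and let $0<\delta\le\frac14$. Let $\tau$ be the transport plan produced by the construction described in the context, and let $\tau^*$ be an optimal transport plan between $P$ and $S$. Then $\|\tau\|\le(1+17\delta)\|\tau^*\|$.
   Context: Each segment's mass equals its length and is spread uniformly over it (density one). A transport plan from $P$ to $S$ assigns to each $p\in P$ and each point $x$ on the segments a density $\tau_p(x)\in[0,1]$ such that each $p$ sends total mass $\|p\|$ (its weight) and each point $x$ receives total density $1$; its cost is $\|\tau\|=\sum_p\int\tau_p(x)\,\|p-x\|_2\,dx$, and $\|\tau^*\|$ is the minimum cost (earth mover's distance). Construction: (1) Subdivide $S$: repeatedly, for each current subsegment $s'$, if some point of $P$ has all of $s'$ within Euclidean distance $\delta/(nm)$, leave $s'$; otherwise, if some $p\in P$ has ratio of largest to smallest distance from $p$ to points of $s'$ exceeding $1+\delta$, cut $s'$ in half. Call the resulting subsegments $Q$. (2) Choose an arbitrary point on each $q\in Q$ with weight equal to the length of $q$; call this weighted point set $T$. (3) Compute an optimal transport plan $\nu$ between the weighted point sets $P$ and $T$ (Euclidean distances). (4) Obtain $\tau$ by spreading the mass that $\nu$ sends to each point $t\in T$ uniformly over the subsegment $q\in Q$ from which $t$ was chosen. *)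

(* Defs.v *)
From HB Require Import structures.
From mathcomp Require Import all_boot all_order all_algebra.
From mathcomp Require Import all_classical all_reals all_analysis.
Set Implicit Arguments. Unset Strict Implicit. Unset Printing Implicit Defensive.
Import Order.TTheory GRing.Theory Num.Theory.
Local Open Scope ring_scope.
Local Open Scope classical_set_scope.

Section Defs.
Context {R : realType}.

Definition pt2 := (R * R)%type.

Definition I01 : set R := `[0%R, 1%R]%classic.

Definition dist2 (x y : pt2) : R :=
  Num.sqrt ((x.1 - y.1) ^+ 2 + (x.2 - y.2) ^+ 2).

Definition segpt (a b : pt2) (u : R) : pt2 :=
  (a.1 + u * (b.1 - a.1), a.2 + u * (b.2 - a.2)).

Variables (n m : nat) (p : 'I_n -> pt2) (w : 'I_n -> R)
          (a b : 'I_m -> pt2) (delta : R).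

Definition seglen (j : 'I_m) : R := dist2 (a j) (b j).

Definition sx (j : 'I_m) (u : R) : pt2 := segpt (a j) (b j) u.

(* A cell (j, d, k) is the subsegment of s_j with parameter range
   [k / 2^d, (k+1) / 2^d]  (obtained after d halvings). *)
Definition cell := ('I_m * nat * nat)%type.
Definition cseg (c : cell) : 'I_m := c.1.1.
Definition cdepth (c : cell) : nat := c.1.2.
Definition cidx (c : cell) : nat := c.2.
Definition valid_cell (c : cell) : Prop := (cidx c < 2 ^ cdepth c)%N.
Definition clo (c : cell) : R := (cidx c)%:R / 2 ^+ cdepth c.
Definition chi (c : cell) : R := (cidx c).+1%:R / 2 ^+ cdepth c.
Definition in_cell (c : cell) (u : R) : Prop := clo c <= u <= chi c.
Definition clen (c : cell) : R := seglen (cseg c) / 2 ^+ cdepth c.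

Definition canc (c : cell) (d' : nat) : cell :=
  (cseg c, d', (cidx c %/ 2 ^ (cdepth c - d'))%N).

Definition cell_close (c : cell) : Prop :=
  exists i : 'I_n, forall u, in_cell c u ->
    dist2 (p i) (sx (cseg c) u) <= delta / (n * m)%:R.

(* "some p has ratio of largest to smallest distance to points of s'
    exceeding 1 + delta"  (max > (1+delta) min; max/min are attained) *)
Definition cell_ratio_big (c : cell) : Prop :=
  exists i : 'I_n, exists u v, in_cell c u /\ in_cell c v /\
    dist2 (p i) (sx (cseg c) u) > (1 + delta) * dist2 (p i) (sx (cseg c) v).

Definition cell_cut (c : cell) : Prop := ~ cell_close c /\ cell_ratio_big c.

(* c belongs to the final subdivision Q: all its strict ancestors were cut
   and c itself is left *)
Definition inQ (c : cell) : Prop :=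
  valid_cell c /\ ~ cell_cut c /\
  forall d' : nat, (d' < cdepth c)%N -> cell_cut (canc c d').

(* Qs enumerates Q, t c is the parameter of the chosen point on c *)
Definition disc_plan (Qs : seq cell) (nu : 'I_n -> cell -> R) : Prop :=
  (forall i c, c \in Qs -> 0 <= nu i c) /\
  (forall i, \sum_(c <- Qs) nu i c = w i) /\
  (forall c, c \in Qs -> \sum_(i < n) nu i c = clen c).

Definition disc_cost (Qs : seq cell) (t : cell -> R) (nu : 'I_n -> cell -> R) : R :=
  \sum_(i < n) \sum_(c <- Qs) nu i c * dist2 (p i) (sx (cseg c) (t c)).

Definition disc_optimal (Qs : seq cell) (t : cell -> R) (nu : 'I_n -> cell -> R) : Prop :=
  disc_plan Qs nu /\
  forall nu', disc_plan Qs nu' -> disc_cost Qs t nu <= disc_cost Qs t nu'.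

(* tau i j u = density sent by p_i to the point sx j u of s_j
   (u in [0,1]; arc-length element dx = seglen j du) *)
Definition plan (tau : 'I_n -> 'I_m -> R -> R) : Prop :=
  (forall i j, measurable_fun I01 (tau i j)) /\
  (forall i j u, 0 <= u <= 1 -> 0 <= tau i j u <= 1) /\
  (forall j u, 0 <= u <= 1 -> \sum_(i < n) tau i j u = 1) /\
  (forall i, (\sum_(j < m)
      \int[lebesgue_measure]_(u in I01) (tau i j u * seglen j)%:E
      = (w i)%:E)%E).

Definition plan_cost (tau : 'I_n -> 'I_m -> R -> R) : \bar R :=
  (\sum_(i < n) \sum_(j < m)
    \int[lebesgue_measure]_(u in I01)
       (tau i j u * dist2 (p i) (sx j u) * seglen j)%:E)%E.

Definition spread (Qs : seq cell) (nu : 'I_n -> cell -> R) : 'I_n -> 'I_m -> R -> R :=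
  fun i j u => \sum_(c <- Qs | cseg c == j)
    (nu i c / clen c) * (if (clo c <= u) && (u < chi c) then 1 else 0).

End Defs.

(* Main.v *)
Require Import Defs.
From HB Require Import structures.
From mathcomp Require Import all_boot all_order all_algebra.
From mathcomp Require Import all_classical all_reals all_analysis.
From mathcomp Require Import measurable_realfun.
From mathcomp Require Import ring lra.
Import Order.TTheory GRing.Theory Num.Theory.
Local Open Scope ring_scope.

(** The discretised problem is compared with the continuous one pointwise.  Put
    [r = delta / (n m)].  On a subsegment of [Q], replacing a point [x] by the
    chosen point changes its distance to any [p_i] by a factor at most
    [1 + delta], plus an error at most [2 r] that is only needed on subsegments
    lying within [r] of some [p_k].  The [r]-neighbourhoods of the [n] points
    meet the [m] segments in total length at most [2 r n m = 2 delta], so this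
    error costs every plan at most [E = 4 delta^2 / (n m)].  Since [nu] is at
    most as expensive as the discretisation of [tau*], the cost of [tau] is at
    most [(1 + delta) ((1 + delta) |tau*| + E) + E].

    The same length bound for the radii [1 / (6 n m)] and [2 / (6 n m)] leaves
    mass at least [2/3], resp. [1/3], outside the neighbourhoods, so that
    [|tau*| >= 1 / (6 n m)] and [E <= 24 delta^2 |tau*|], which suffices for
    [delta <= 1/4]. *)

Set Implicit Arguments. Unset Strict Implicit. Unset Printing Implicit Defensive.

(** * Euclidean distance in the plane and projection of a point on a line *)

Section Geometry.
Context {R : realType}.
Implicit Types x y z p a b : @pt2 R.

Lemma dist2_ge0 x y : 0 <= dist2 x y.
Proof. exact: sqrtr_ge0. Qed.

Lemma dist2_sqr x y : dist2 x y ^+ 2 = (x.1 - y.1) ^+ 2 + (x.2 - y.2) ^+ 2.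
Proof. by rewrite /dist2 sqr_sqrtr // addr_ge0 ?sqr_ge0. Qed.

Lemma dist2C x y : dist2 x y = dist2 y x.
Proof. by rewrite /dist2 -[x.1 - _]opprB -[x.2 - _]opprB !sqrrN. Qed.

(** With [u = x - y] and [v = y - z], squaring reduces the claim to Cauchy-Schwarz, which follows
    from Lagrange's identity [|u|^2 |v|^2 - <u,v>^2 = (u1 v2 - u2 v1)^2]. *)
Lemma dist2_triangle y x z : dist2 x z <= dist2 x y + dist2 y z.
Proof.
have s0 : 0 <= dist2 x y + dist2 y z by rewrite addr_ge0 ?dist2_ge0.
rewrite -(@ler_pXn2r _ 2) ?nnegrE ?dist2_ge0 // sqrrD !dist2_sqr.
set u1 := x.1 - y.1; set u2 := x.2 - y.2.
set v1 := y.1 - z.1; set v2 := y.2 - z.2.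
have -> : x.1 - z.1 = u1 + v1 by rewrite /u1 /v1; ring.
have -> : x.2 - z.2 = u2 + v2 by rewrite /u2 /v2; ring.
have cs : u1 * v1 + u2 * v2 <= dist2 x y * dist2 y z.
  have /ler_normlW//: `|u1 * v1 + u2 * v2| <= dist2 x y * dist2 y z.
  rewrite -(@ler_pXn2r _ 2) ?nnegrE ?mulr_ge0 ?dist2_ge0 //.
  rewrite real_normK ?num_real // exprMn !dist2_sqr -/u1 -/u2 -/v1 -/v2.
  rewrite -subr_ge0.
  have -> : (u1 ^+ 2 + u2 ^+ 2) * (v1 ^+ 2 + v2 ^+ 2) - (u1 * v1 + u2 * v2) ^+ 2
     = (u1 * v2 - u2 * v1) ^+ 2 by ring.
  exact: sqr_ge0.
rewrite -mulr_natr.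
by nra.
Qed.

Lemma dist2_segpt a b u v :
  dist2 (segpt a b u) (segpt a b v) = `|u - v| * dist2 a b.
Proof.
rewrite /dist2 /segpt /= -sqrtr_sqr -sqrtrM ?sqr_ge0 //; congr Num.sqrt.
by ring.
Qed.

(* The parameter of the orthogonal projection of [p] on the line [ab]
   (it is [0] when [a = b]). *)
Definition proj_param p a b : R :=
  ((p.1 - a.1) * (b.1 - a.1) + (p.2 - a.2) * (b.2 - a.2)) / dist2 a b ^+ 2.

(** The left side is the component of the distance along the line, so this is Pythagoras: after
    multiplication by [dist2 a b] and squaring, the gap is the square of a cross product. It traps
    the part of a segment near [p] in a parameter interval. *)
Lemma proj_param_le p a b u : `|u - proj_param p a b| * dist2 a b <= dist2 p (segpt a b u).
Proof.
have [->|L0] := eqVneq (dist2 a b) 0; first by rewrite mulr0 dist2_ge0.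
have Lp : 0 < dist2 a b by rewrite lt_neqAle eq_sym L0 dist2_ge0.
have L2 := dist2_sqr a b.
set e1 := b.1 - a.1; set e2 := b.2 - a.2.
have {}L2 : dist2 a b ^+ 2 = e1 ^+ 2 + e2 ^+ 2 by rewrite L2 /e1 /e2; ring.
rewrite -(ler_pM2r Lp) -(@ler_pXn2r _ 2) ?nnegrE ?mulr_ge0 ?dist2_ge0 //.
rewrite -mulrA -expr2 exprMn real_normK ?num_real // -(exprMn _ (u - _)).
rewrite mulrBl divfK ?sqrf_eq0 // exprMn L2 (dist2_sqr p) /segpt /= -/e1 -/e2.
set f1 := p.1 - a.1; set f2 := p.2 - a.2.
have -> : p.1 - (a.1 + u * e1) = f1 - u * e1 by rewrite /f1; ring.
have -> : p.2 - (a.2 + u * e2) = f2 - u * e2 by rewrite /f2; ring.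
rewrite -subr_ge0.
have -> : ((f1 - u * e1) ^+ 2 + (f2 - u * e2) ^+ 2) * (e1 ^+ 2 + e2 ^+ 2)
   - (u * (e1 ^+ 2 + e2 ^+ 2) - (f1 * e1 + f2 * e2)) ^+ 2
   = ((f1 - u * e1) * e2 - (f2 - u * e2) * e1) ^+ 2 by ring.
exact: sqr_ge0.
Qed.

Lemma measurable_dist2_segpt p a b D :
  measurable_fun D (fun u => dist2 p (segpt a b u)).
Proof.
have mX (k c e : R) : measurable_fun setT (fun u : R => (k - (c + u * e)) ^+ 2).
  apply: measurable_funX; apply: measurable_funB => //.
  by apply: measurable_funD => //; apply: measurable_funM.
apply: measurable_funTS.
pose g u : R := (p.1 - (a.1 + u * (b.1 - a.1))) ^+ 2
          + (p.2 - (a.2 + u * (b.2 - a.2))) ^+ 2.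
have mg : measurable_fun setT g by exact: measurable_funD.
have ms : measurable_fun setT (@Num.sqrt R).
  by apply: continuous_measurable_fun; exact: sqrt_continuous.
exact: (measurableT_comp ms mg).
Qed.

End Geometry.

(** * Dyadic cells and the subdivision [Q] *)

Section Cells.
Context {R : realType} {n m : nat}.
Implicit Types (c : cell m) (u v : R).

(** Half-open, unlike [in_cell], so that distinct cells of one segment and one depth are disjoint;
    this is also the test made by [spread]. *)
Definition in_cello c u : bool := (clo c <= u) && (u < chi c).

Lemma in_celloE c u :
  in_cello c u = ((cidx c)%:R <= u * 2 ^+ cdepth c < (cidx c).+1%:R).
Proof.
by rewrite /in_cello /clo /chi ler_pdivrMr ?ltr_pdivlMr // exprn_gt0.
Qed.

Lemma in_cello_cell c u : in_cello c u -> in_cell c u.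
Proof. by move=> /andP[h1 /ltW h2]; apply/andP. Qed.

Lemma chiB c : chi c - clo c = 1 / 2 ^+ cdepth c :> R.
Proof. by rewrite /chi /clo -mulrBl -natrB // subSnn. Qed.

Lemma in_cell_dist c u v : in_cell c u -> in_cell c v ->
  `|u - v| <= 1 / 2 ^+ cdepth c.
Proof.
rewrite -chiB => /andP[u1 u2] /andP[v1 v2].
by rewrite ler_norml; apply/andP; split; lra.
Qed.

Lemma in_cello_canc c d u : (d <= cdepth c)%N -> in_cello c u ->
  in_cello (canc c d) u.
Proof.
case: c => [[j e] k]; rewrite !in_celloE /canc /cidx /cdepth /= => de.
have p2 : (0 < 2 ^ (e - d))%N by rewrite expn_gt0.
have P2 : 0 < 2 ^+ (e - d) :> R by rewrite exprn_gt0.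
rewrite -(subnKC de) addKn exprD mulrA => /andP[h1 h2].
have nX q : q%:R * 2 ^+ (e - d) = (q * 2 ^ (e - d))%:R :> R by rewrite natrM natrX.
apply/andP; split.
  rewrite -(ler_pM2r P2) nX.
  by apply: le_trans h1; rewrite ler_nat leq_divM.
rewrite -(ltr_pM2r P2) nX.
by apply: lt_le_trans h2 _; rewrite ler_nat ltn_ceil.
Qed.

(** Both indices are the integer part of [u * 2 ^+ cdepth c]. *)
Lemma in_cello_inj c c' u : cseg c = cseg c' -> cdepth c = cdepth c' ->
  in_cello c u -> in_cello c' u -> c = c'.
Proof.
case: c => [[j e] k]; case: c' => [[j' e'] k'].
rewrite !in_celloE /cseg /cdepth /cidx /= => -> -> /truncn_def h /truncn_def h'.
by rewrite -h -h'.
Qed.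

Definition cell_at (j : 'I_m) (d : nat) u : cell m := (j, d, Num.trunc (u * 2 ^+ d)).

Lemma in_cell_at j d u : 0 <= u -> in_cello (cell_at j d u) u.
Proof.
by move=> u0; rewrite in_celloE truncn_itv // mulr_ge0 // exprn_ge0.
Qed.

Lemma valid_cell_at j d u : 0 <= u < 1 -> valid_cell (cell_at j d u).
Proof.
move=> /andP[u0 u1]; rewrite /valid_cell /cidx /cdepth /=.
rewrite truncn_lt_nat ?mulr_ge0 ?exprn_ge0 // natrX.
by rewrite gtr_pMl // exprn_gt0.
Qed.

Lemma expr2_arch (x e : R) : 0 < e -> exists d : nat, x / 2 ^+ d <= e.
Proof.
move=> e0; exists (Num.trunc (x / e)).+1.
rewrite ler_pdivrMr ?exprn_gt0 // -ler_pdivrMl // mulrC.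
apply: le_trans (ltW (truncnS_gt _)) _.
by rewrite -natrX ler_nat ltnW // ltn_expl.
Qed.

Variables (p : 'I_n -> @pt2 R) (a b : 'I_m -> @pt2 R) (delta : R).
Hypotheses (n0 : (0 < n)%N) (delta0 : 0 < delta).

Lemma close_or_ratio c : ~ cell_cut p a b delta c ->
  cell_close p a b delta c \/
  forall i u v, in_cell c u -> in_cell c v ->
    dist2 (p i) (sx a b (cseg c) u) <= (1 + delta) * dist2 (p i) (sx a b (cseg c) v).
Proof.
move=> nc; have [|ncl] := pselect (cell_close p a b delta c); [by left|right].
move=> i u v hu hv; rewrite leNgt; apply/negP => h.
by apply: nc; split=> //; exists i, u, v.
Qed.

(** Halving stops around every [u]. If some [p i] is the point at [u], a short enough cell is close
    to it; otherwise all distances from that point are bounded below, and a short cell has distance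
    ratios at most [1 + delta]. *)
Lemma not_cut_at j u : 0 <= u -> exists d, ~ cell_cut p a b delta (cell_at j d u).
Proof.
move=> u0; have m0 : (0 < m)%N by case: m j => [[]|].
have L0 := dist2_ge0 (a j) (b j).
have near d v : in_cell (cell_at j d u) v ->
    dist2 (sx a b j u) (sx a b j v) <= seglen a b j / 2 ^+ d.
  move=> hv; rewrite /sx dist2_segpt mulrC ler_wpM2l //.
  by rewrite -div1r; apply: (in_cell_dist _ hv); exact/in_cello_cell/in_cell_at.
have [[i di]|nz] := pselect (exists i, dist2 (p i) (sx a b j u) = 0).
  have [|d hd] := @expr2_arch (seglen a b j) (delta / (n * m)%:R).
    by rewrite divr_gt0 // ltr0n muln_gt0 n0.
  exists d => -[ncl _]; apply: ncl; exists i => v /near h.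
  apply: le_trans (dist2_triangle (sx a b j u) _ _) _.
  by rewrite di add0r (le_trans h).
(* The default value 1 is harmless: only [0 < rho] and [rho <= dist2 (p i) _] are used. *)
pose rho := \big[Num.min/1]_i dist2 (p i) (sx a b j u).
have rho0 : 0 < rho.
  apply: lt_bigmin => // i _; rewrite lt_neqAle dist2_ge0 andbT eq_sym.
  by apply/eqP => h; apply: nz; exists i.
(* For a cell of length [l] and a point at distance [D], the bound [D + l <= (1 + delta) (D - l)]
   amounts to [(2 + delta) l <= delta D]. *)
have [|d hd] := @expr2_arch (seglen a b j) (delta / (2 + delta) * rho).
  by rewrite mulr_gt0 ?divr_gt0 ?addr_gt0.
exists d => -[_ [i [v1 [v2 [/near h1 [/near h2]]]]]]; apply/negP; rewrite -leNgt.
have ri : rho <= dist2 (p i) (sx a b j u) := bigmin_le _ _ _.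
have {}ri : (2 + delta) * (seglen a b j / 2 ^+ d) <= delta * dist2 (p i) (sx a b j u).
  rewrite mulrAC ler_pdivlMr ?addr_gt0 // mulrC in hd.
  by rewrite (le_trans hd) // ler_wpM2l // ltW.
have t1 := dist2_triangle (sx a b j u) (p i) (sx a b j v1).
have t2 := dist2_triangle (sx a b j v2) (p i) (sx a b j u).
rewrite (dist2C (sx a b j v2)) in t2.
rewrite /cseg /=.
have : (1 + delta) * (dist2 (p i) (sx a b j u) - seglen a b j / 2 ^+ d)
    <= (1 + delta) * dist2 (p i) (sx a b j v2).
  by apply: ler_wpM2l; [rewrite addr_ge0 // ltW|lra].
lra.
Qed.

(** Take the smallest depth at which the cell around [u] is not cut: by minimality all its strict
    ancestors were cut. The value [u = 1] is excluded because no valid half-open cell contains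
    it. *)
Lemma inQ_exists j u : 0 <= u < 1 ->
  exists c, [/\ inQ p a b delta c, cseg c = j & in_cello c u].
Proof.
move=> /[dup] u01 /andP[u0 u1].
have ex : exists d, `[< ~ cell_cut p a b delta (cell_at j d u) >].
  by have [d hd] := not_cut_at j u0; exists d; apply/asboolP.
have [d /asboolP nd dmin] := ex_minnP ex.
exists (cell_at j d u); split=> //; last exact: in_cell_at.
split; first exact: valid_cell_at.
split=> // d' dd'; apply: contrapT => nc.
have : (d <= d')%N.
  apply: dmin; apply/asboolP; suff <- : canc (cell_at j d u) d' = cell_at j d' u by [].
  apply: (in_cello_inj (u := u)) => //; last exact: in_cell_at.
  by apply: in_cello_canc; [exact: ltnW|exact: in_cell_at].
by rewrite leqNgt dd'.
Qed.

(** The shallower cell is an ancestor of the deeper one; a strict ancestor would have been cut, so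
    the depths agree. *)
Lemma inQ_inj c c' u : inQ p a b delta c -> inQ p a b delta c' ->
  cseg c = cseg c' -> in_cello c u -> in_cello c' u -> c = c'.
Proof.
wlog le : c c' / (cdepth c <= cdepth c')%N => [wl|].
  have [|/ltnW] := leqP (cdepth c) (cdepth c'); first exact: wl.
  by move=> ? ? ? ? ? ?; apply/esym; exact: wl.
move=> [_ [nc _]] [_ [_ cc']] jj hc hc'.
have E : canc c' (cdepth c) = c.
  by apply: (in_cello_inj (u := u)) => //; exact: in_cello_canc.
move: le; rewrite leq_eqVlt => /orP[/eqP dd|dd]; first exact: (in_cello_inj (u := u)).
by case: nc; rewrite -E; exact: cc'.
Qed.

End Cells.

(** * Calculus of plan costs for a general price function *)

Section WeightedCost.
Context {R : realType} {n m : nat}.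
Variable L : 'I_m -> R.
Hypothesis L0 : forall j, 0 <= L j.
Local Notation mu := (@lebesgue_measure R).
Local Notation U := (`[0%R, 1%R[%classic : set R).
Implicit Types (tau f g : 'I_n -> 'I_m -> R -> R) (h : R -> R).

(** The price [f] stands in place of the distance, so that true distances, distances to chosen
    points, constants and tube counts share one calculus. Integrals run over [[0,1[] to match the
    half-open cells. *)
Definition wcost tau f : \bar R :=
  (\sum_(i < n) \sum_(j < m) \int[mu]_(u in U) (tau i j u * f i j u * L j)%:E)%E.

(** For such functions the extended-real integral is monotone and additive without any integrability
    condition. *)
Definition nnmeas (h : R -> R) : Prop :=
  measurable_fun U h /\ forall u, 0 <= u < 1 -> 0 <= h u.

Let mU : measurable U. Proof. exact: measurable_itv. Qed.

Lemma nnmeasM h1 h2 : nnmeas h1 -> nnmeas h2 -> nnmeas (fun u => h1 u * h2 u).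
Proof.
move=> [m1 p1] [m2 p2]; split; first exact: measurable_funM.
by move=> u hu; rewrite mulr_ge0 ?p1 ?p2.
Qed.

Lemma nnmeasD h1 h2 : nnmeas h1 -> nnmeas h2 -> nnmeas (fun u => h1 u + h2 u).
Proof.
move=> [m1 p1] [m2 p2]; split; first exact: measurable_funD.
by move=> u hu; rewrite addr_ge0 ?p1 ?p2.
Qed.

Lemma nnmeas_cst k : 0 <= k -> nnmeas (fun=> k).
Proof. by move=> k0; split. Qed.

Lemma nnmeasMr h k : 0 <= k -> nnmeas h -> nnmeas (fun u => h u * k).
Proof. by move=> k0 hh; apply: nnmeasM => //; exact: nnmeas_cst. Qed.

Lemma nnmeas_sum I (s : seq I) (P : pred I) (h : I -> R -> R) :
  (forall i, nnmeas (h i)) -> nnmeas (fun u => \sum_(i <- s | P i) h i u).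
Proof.
move=> hh; split.
  have -> : (fun u => \sum_(i <- s | P i) h i u)
      = (fun u => \sum_(i <- [seq i <- s | P i]) h i u).
    by apply/funext => u; rewrite big_filter.
  by apply: measurable_sum => i; case: (hh i).
by move=> u hu; apply: sumr_ge0 => i _; case: (hh i) => _; exact.
Qed.

Lemma nnmeas_EFin h : nnmeas h ->
  measurable_fun U (EFin \o h) /\ forall u, U u -> (0 <= (h u)%:E)%E.
Proof.
move=> [mh p]; split; first exact/measurable_EFinP.
by move=> u; rewrite /= in_itv /= => hu; rewrite lee_fin p.
Qed.

Lemma le_int h1 h2 : nnmeas h1 -> nnmeas h2 ->
  (forall u, 0 <= u < 1 -> h1 u <= h2 u) ->
  (\int[mu]_(u in U) (h1 u)%:E <= \int[mu]_(u in U) (h2 u)%:E)%E.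
Proof.
move=> /nnmeas_EFin[m1 p1] /nnmeas_EFin[m2 p2] h12.
by apply: ge0_le_integral => // u; rewrite /= in_itv /= => hu; rewrite lee_fin h12.
Qed.

Lemma eq_int h1 h2 : (forall u, 0 <= u < 1 -> h1 u = h2 u) ->
  (\int[mu]_(u in U) (h1 u)%:E = \int[mu]_(u in U) (h2 u)%:E)%E.
Proof.
by move=> h12; apply: eq_integral => u; rewrite inE /= in_itv /= => hu; rewrite h12.
Qed.

Lemma int_sum I (s : seq I) (P : pred I) (h : I -> R -> R) :
  (forall i, nnmeas (h i)) ->
  (\int[mu]_(u in U) (\sum_(i <- s | P i) h i u)%:E
   = \sum_(i <- s | P i) \int[mu]_(u in U) (h i u)%:E)%E.
Proof.
move=> hh; rewrite -big_filter.
pose g i u := (h i u)%:E.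
transitivity (\int[mu]_(u in U) \sum_(i <- [seq i <- s | P i]) g i u)%E.
  by apply: eq_integral => u _; rewrite big_filter sumEFin.
apply: ge0_integral_sum => //.
- by move=> i; case: (nnmeas_EFin (hh i)).
- by move=> i u; case: (nnmeas_EFin (hh i)) => _; exact.
Qed.

Lemma int_scale h k : 0 <= k -> nnmeas h ->
  (\int[mu]_(u in U) (k * h u)%:E = k%:E * \int[mu]_(u in U) (h u)%:E)%E.
Proof.
move=> k0 /nnmeas_EFin[mh ph]; rewrite -ge0_integralZl_EFin //.
Qed.

(** A degenerate segment contributes 0 to both sides, so prices are compared only where [L j != 0],
    which is where [tubes] detects closeness. *)
Lemma le_wcost tau f g :
  (forall i j, nnmeas (tau i j)) -> (forall i j, nnmeas (f i j)) ->
  (forall i j, nnmeas (g i j)) ->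
  (forall i j u, L j != 0 -> 0 <= u < 1 -> f i j u <= g i j u) ->
  (wcost tau f <= wcost tau g)%E.
Proof.
move=> ht hf hg fg; apply: lee_sum => i _; apply: lee_sum => j _.
apply: le_int.
- by apply: nnmeasMr => //; exact: nnmeasM.
- by apply: nnmeasMr => //; exact: nnmeasM.
- move=> u hu; have [->|Lj] := eqVneq (L j) 0; first by rewrite !mulr0.
  by rewrite ler_wpM2r // ler_wpM2l ?fg //; case: (ht i j) => _; exact.
Qed.

Lemma wcostD tau f g (k l : R) : 0 <= k -> 0 <= l ->
  (forall i j, nnmeas (tau i j)) -> (forall i j, nnmeas (f i j)) ->
  (forall i j, nnmeas (g i j)) ->
  (wcost tau (fun i j u => k * f i j u + l * g i j u)%R
   = k%:E * wcost tau f + l%:E * wcost tau g)%E.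
Proof.
move=> k0 l0 ht hf hg.
have nn (h : 'I_n -> 'I_m -> R -> R) : (forall i j, nnmeas (h i j)) -> forall i j,
    nnmeas (fun u => tau i j u * h i j u * L j).
  by move=> hh i j; apply: nnmeasMr => //; exact: nnmeasM.
have pos (h : 'I_n -> 'I_m -> R -> R) i j : (forall i j, nnmeas (h i j)) ->
    (0 <= \int[mu]_(u in U) (tau i j u * h i j u * L j)%:E)%E.
  move=> /nn/(_ i j)/nnmeas_EFin[_ hp]; exact: integral_ge0.
have E (h : 'I_n -> 'I_m -> R -> R) c : 0 <= c -> (forall i j, nnmeas (h i j)) -> (c%:E * wcost tau h
   = \sum_(i < n) \sum_(j < m) c%:E * \int[mu]_(u in U) (tau i j u * h i j u * L j)%:E)%E.
  move=> c0 hh; rewrite /wcost ge0_sume_distrr; last by move=> i _; apply: sume_ge0 => j _; exact: pos.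
  by apply: eq_bigr => i _; rewrite ge0_sume_distrr // => j _; exact: pos.
rewrite !E // -big_split; apply: eq_bigr => i _ /=.
rewrite -big_split; apply: eq_bigr => j _ /=.
rewrite -!int_scale //; try exact: nn.
have [m1 p1] := nnmeas_EFin (nnmeasM (nnmeas_cst k0) (nn _ hf i j)).
have [m2 p2] := nnmeas_EFin (nnmeasM (nnmeas_cst l0) (nn _ hg i j)).
rewrite -ge0_integralD //; apply: eq_integral => u _.
by rewrite -EFinD; congr EFin; ring.
Qed.

(** When the price does not depend on the source, only the total density at each point matters. *)
Lemma wcost_common tau (h : 'I_m -> R -> R) : (forall i j, nnmeas (tau i j)) ->
  (forall j, nnmeas (h j)) ->
  (wcost tau (fun=> h)
   = \sum_(j < m) \int[mu]_(u in U) ((\sum_(i < n) tau i j u) * (h j u * L j))%:E)%E.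
Proof.
move=> ht hh; rewrite /wcost exchange_big; apply: eq_bigr => j _ /=.
rewrite -int_sum; last by move=> i; apply: nnmeasMr => //; exact: nnmeasM.
by apply: eq_int => u _; rewrite mulr_suml; apply: eq_bigr => i _; rewrite mulrA.
Qed.

Lemma wcost_cst tau k : 0 <= k -> (forall i j, nnmeas (tau i j)) ->
  (forall j u, 0 <= u < 1 -> \sum_(i < n) tau i j u = 1) ->
  wcost tau (fun _ _ _ => k) = (k * \sum_(j < m) L j)%:E.
Proof.
move=> k0 ht t1; rewrite wcost_common //.
rewrite mulr_sumr -sumEFin; apply: eq_bigr => j _.
rewrite (@eq_int _ (fun=> k * L j)); last by move=> u /t1 ->; rewrite mul1r.
have muU : mu U = 1%E by rewrite /= lebesgue_measure_itv /= lte_fin ltr01 sube0.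
transitivity ((k * L j)%:E * mu U)%E; first exact: integral_cst.
by rewrite muU mule1.
Qed.

(* When [c i j] is the projection of [p_i] on the segment [j] and [L j != 0],
   the [i]-th interval contains all parameters of points within [r] of [p_i]. *)
Definition tubes (c : 'I_n -> 'I_m -> R) (r : R) (j : 'I_m) (u : R) : R :=
  \sum_(i < n) \1_(`[c i j - r / L j, c i j + r / L j]%classic : set R) u.

Lemma nnmeas_indic (A : set R) : measurable A -> nnmeas (\1_A).
Proof.
by move=> mA; split; [exact: measurable_indic|move=> u _; rewrite indicE ler0n].
Qed.

Lemma int_indic (A : set R) (k : R) : measurable A -> 0 <= k ->
  (\int[mu]_(u in U) (\1_A u * k)%:E = k%:E * mu (A `&` U)%classic)%E.
Proof.
move=> mA k0; rewrite -integral_indic // -(int_scale k0 (nnmeas_indic mA)).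
by apply: eq_int => u _; rewrite mulrC.
Qed.

Lemma nnmeas_tubes c r j : nnmeas (tubes c r j).
Proof. by apply: nnmeas_sum => i; apply: nnmeas_indic; exact: measurable_itv. Qed.

Lemma tubes_ge0 c r j u : 0 <= tubes c r j u.
Proof. by apply: sumr_ge0 => i _; rewrite indicE ler0n. Qed.

Lemma tubes_ge1 c r i j u : L j != 0 -> `|u - c i j| * L j <= r ->
  1 <= tubes c r j u.
Proof.
move=> Lj h; have Lp : 0 < L j by rewrite lt_neqAle eq_sym Lj L0.
rewrite /tubes (bigD1 i) //= indicE mem_set ?lerDl.
  by apply: sumr_ge0 => k _; rewrite indicE ler0n.
by move: h; rewrite -ler_pdivlMr //= in_itv /= -ler_distl.
Qed.

(** Each interval has parameter length [2 r / L j], hence arc length [2 r], and there are [n * m] of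
    them; overlaps are counted with multiplicity. *)
Lemma wcost_tubes tau c r : 0 <= r -> (forall i j, nnmeas (tau i j)) ->
  (forall j u, 0 <= u < 1 -> \sum_(i < n) tau i j u <= 1) ->
  (wcost tau (fun=> tubes c r) <= (2 * r * (n * m)%:R)%:E)%E.
Proof.
move=> r0 ht t1; rewrite wcost_common //; last exact: nnmeas_tubes.
have -> : (2 * r * (n * m)%:R)%:E = (\sum_(j < m) \sum_(i < n) (2 * r)%:E)%E.
  under eq_bigr do rewrite sumEFin.
  rewrite sumEFin !big_const !card_ord !iter_addr !addr0 -mulrnA mulr_natr //.
apply: lee_sum => j _.
have nt := nnmeasMr (L0 j) (nnmeas_tubes c r j).
apply: le_trans (le_int (h2 := fun u => tubes c r j u * L j) _ nt _) _.
- by apply: nnmeasM => //; exact: nnmeas_sum.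
- move=> u hu; rewrite ler_piMl ?t1 // mulr_ge0 //; exact: tubes_ge0.
under eq_integral do rewrite mulr_suml.
rewrite int_sum; last by move=> i; apply: nnmeasMr => //; exact: nnmeas_indic.
apply: lee_sum => i _; rewrite int_indic //.
(* On a degenerate segment the weight is 0, whatever interval [r / L j] defines. *)
have [->|Lj] := eqVneq (L j) 0; first by rewrite mul0e lee_fin mulr_ge0.
have Lp : 0 < L j by rewrite lt_neqAle eq_sym Lj L0.
set I := (X in mu (X `&` _)%classic).
apply: (@le_trans _ _ ((L j)%:E * mu I)%E).
  rewrite lee_wpmul2l ?lee_fin //; apply: le_measure; rewrite ?inE.
  - by apply: measurableI; exact: measurable_itv.
  - exact: measurable_itv.
  - exact: subIsetl.
rewrite /I lebesgue_measure_itv /= lte_fin; case: ifP => _; last first.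
  by rewrite mule0 lee_fin mulr_ge0.
rewrite -EFinB -EFinM lee_fin le_eqVlt; apply/orP; left; apply/eqP.
by field.
Qed.

End WeightedCost.

(** * Cell masses and the spread plan *)

Section Plans.
Context {R : realType} {n m : nat}.
Variables (p : 'I_n -> @pt2 R) (w : 'I_n -> R) (a b : 'I_m -> @pt2 R) (delta : R).
Hypotheses (n0 : (0 < n)%N) (m0 : (0 < m)%N).
Hypotheses (delta0 : 0 < delta) (L1 : \sum_(j < m) seglen a b j = 1).
Variables (Qs : seq (cell m)) (t : cell m -> R).
Hypotheses (uQ : uniq Qs) (Qin : forall c, c \in Qs <-> inQ p a b delta c).
Hypothesis tin : forall c, c \in Qs -> in_cell c (t c).
Local Notation mu := (@lebesgue_measure R).
Local Notation U := (`[0%R, 1%R[%classic : set R).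
Local Notation L := (seglen a b).
Local Notation N := ((n * m)%:R : R).
Local Notation ind c u := (if (clo c <= u) && (u < chi c) then 1 else 0).

Let L0 j : 0 <= L j. Proof. exact: dist2_ge0. Qed.

Let N0 : 0 < N. Proof. by rewrite ltr0n muln_gt0 n0 m0. Qed.

(** [spread] unfolds to this with [F c = nu i c / clen a b c]; the same form encodes the distance to
    the chosen point of the cell containing [u]. *)
Definition step (F : cell m -> R) (j : 'I_m) (u : R) : R :=
  \sum_(c <- Qs | cseg c == j) F c * ind c u.

Definition mass (g : 'I_m -> R -> R) (c : cell m) : \bar R :=
  (\int[mu]_(u in U) (g (cseg c) u * ind c u * L (cseg c))%:E)%E.

(** The half-open cells of [Q] on one segment partition [[0,1[], so exactly one indicator in the sum
    is nonzero. *)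
Lemma step_at j u : 0 <= u < 1 -> exists c0,
  [/\ c0 \in Qs, cseg c0 = j, in_cello c0 u & forall F, step F j u = F c0].
Proof.
move=> hu; have [c0 [/Qin hQ hj hc]] := inQ_exists p a b n0 delta0 j hu.
exists c0; split=> // F; rewrite /step big_mkcond (bigD1_seq c0) //= hj eqxx.
rewrite -/(in_cello c0 u) hc mulr1 big_seq_cond big1 ?addr0 // => c /andP[cQ cc].
case: ifP => // /eqP cj; rewrite -/(in_cello c u).
case: ifP => h; last by rewrite mulr0.
case/eqP: cc; apply: (inQ_inj (u := u)) h hc; last by rewrite cj hj.
- exact/Qin.
- exact/Qin.
Qed.

Lemma indE (c : cell m) u : ind c u = \1_(`[clo c, chi c[%classic : set R) u :> R.
Proof.
rewrite indicE; case: ifP => h; first by rewrite mem_set //= in_itv.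
by rewrite memNset //= in_itv /= h.
Qed.

Lemma nnmeas_ind (c : cell m) : nnmeas (fun u : R => ind c u).
Proof.
have /nnmeas_indic : measurable (`[clo c, chi c[%classic : set R) by [].
by congr nnmeas; apply/funext => u; rewrite indE.
Qed.

Lemma nnmeas_step F j : (forall c, c \in Qs -> 0 <= F c) -> nnmeas (step F j).
Proof.
(* [F] may be negative outside [Qs], whereas [nnmeas_sum] asks every summand to be nonnegative;
   absolute values change nothing on [Qs]. *)
move=> F0; have -> : step F j =
    (fun u => \sum_(c <- Qs | cseg c == j) `|F c| * ind c u).
  apply/funext => u; rewrite /step big_seq_cond [RHS]big_seq_cond.
  by apply: eq_bigr => c /andP[/F0 Fc _]; rewrite ger0_norm.
apply: nnmeas_sum => c; apply: nnmeasM; last exact: nnmeas_ind.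
exact: nnmeas_cst.
Qed.

Lemma int_cell c (k : R) : c \in Qs -> 0 <= k ->
  (\int[mu]_(u in U) (ind c u * k)%:E)%E = (k / 2 ^+ cdepth c)%:E.
Proof.
move=> /Qin[vc _] k0; under eq_integral do rewrite indE.
have P2 : 0 < 2 ^+ cdepth c :> R by rewrite exprn_gt0.
rewrite int_indic // EFinM; congr (_ * _)%E.
rewrite setIidl; last first.
  move=> u; rewrite /= !in_itv /= => /andP[h1 h2]; apply/andP; split.
    by apply: le_trans h1; rewrite divr_ge0 // ltW.
  by apply: lt_le_trans h2 _; rewrite ler_pdivrMr // mul1r -natrX ler_nat.
have lt : clo c < chi c :> R by rewrite -subr_gt0 chiB divr_gt0.
by rewrite lebesgue_measure_itv /= lte_fin lt -EFinB chiB div1r.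
Qed.

(** The step function is constant on each cell, so the integral splits into cell masses, regrouped
    by segment. *)
Lemma int_step (g : 'I_m -> R -> R) F : (forall j, nnmeas (g j)) ->
  (forall c, 0 <= F c) ->
  (\sum_(j < m) \int[mu]_(u in U) (g j u * step F j u * L j)%:E
   = \sum_(c <- Qs) (F c)%:E * mass g c)%E.
Proof.
move=> hg F0; rewrite [RHS](partition_big (@cseg m) xpredT) //=.
apply: eq_bigr => j _.
have nn (c : cell m) : nnmeas (fun u => g j u * ind c u * L j).
  by apply: nnmeasMr => //; apply: nnmeasM => //; exact: nnmeas_ind.
transitivity (\int[mu]_(u in U)
    (\sum_(c <- Qs | cseg c == j) F c * (g j u * ind c u * L j))%:E)%E.
  apply: eq_int => u _; rewrite /step mulr_sumr mulr_suml.
  by apply: eq_bigr => c _; rewrite !mulrA; congr (_ * _ * _); rewrite mulrC.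
rewrite int_sum; last by move=> c; apply: nnmeasM => //; exact: nnmeas_cst.
by apply: eq_bigr => c /eqP cj; rewrite int_scale // /mass cj.
Qed.

Lemma mass_total (g : 'I_m -> R -> R) : (forall j, nnmeas (g j)) ->
  (\sum_(c <- Qs) mass g c = \sum_(j < m) \int[mu]_(u in U) (g j u * L j)%:E)%E.
Proof.
move=> hg; transitivity (\sum_(c <- Qs) 1%:E * mass g c)%E.
  by apply: eq_bigr => c _; rewrite mul1e.
rewrite -(int_step (F := fun=> 1)) //; apply: eq_bigr => j _; apply: eq_int => u hu.
by have [c [_ _ _ ->]] := step_at j hu; rewrite mulr1.
Qed.

Lemma mass_ge0 (g : 'I_m -> R -> R) c : (forall j, nnmeas (g j)) -> (0 <= mass g c)%E.
Proof.
move=> hg; have nn : nnmeas (fun u => g (cseg c) u * ind c u * L (cseg c)).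
  by apply: nnmeasMr => //; apply: nnmeasM => //; exact: nnmeas_ind.
by have [_ ?] := nnmeas_EFin nn; exact: integral_ge0.
Qed.

Lemma sum_mass (tau : 'I_n -> 'I_m -> R -> R) c : c \in Qs ->
  (forall i j, nnmeas (tau i j)) ->
  (forall j u, 0 <= u < 1 -> \sum_(i < n) tau i j u = 1) ->
  (\sum_(i < n) mass (tau i) c)%E = (clen a b c)%:E.
Proof.
move=> cQ ht t1; rewrite -(int_cell cQ (L0 _)) -int_sum.
  by apply: eq_int => u hu; rewrite -2!mulr_suml t1 // mul1r.
by move=> i; apply: nnmeasMr => //; apply: nnmeasM => //; exact: nnmeas_ind.
Qed.

(** Integrating the uniform density over the cell gives back what [nu] sends there, so spreading
    preserves cell masses. *)
Lemma mass_spread nu i c : c \in Qs -> disc_plan w a b Qs nu ->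
  mass (spread a b Qs nu i) c = (nu i c)%:E.
Proof.
move=> cQ [nu0 [_ nuc]].
have c0 : 0 <= clen a b c by rewrite divr_ge0 // exprn_ge0.
transitivity (\int[mu]_(u in U)
   (ind c u * (nu i c / clen a b c * L (cseg c)))%:E)%E.
  apply: eq_int => u hu; rewrite -[spread _ _ _ _ _ _ _]/(step _ _ _).
  case: ifP => h; last by rewrite mulr0 !mul0r.
  have [c' [c'Q cc' h' ->]] := step_at (cseg c) hu.
  have -> : c' = c by apply: (inQ_inj _ _ cc' h' h); exact/Qin.
  by rewrite mulr1 mul1r.
rewrite int_cell //; last by rewrite mulr_ge0 ?divr_ge0 ?nu0.
(* On a cell of length 0 the density is 0 by the convention for division; [nu i c] vanishes too,
   being one of the nonnegative terms of a zero sum. *)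
congr EFin; have [z|nz] := eqVneq (clen a b c) 0; last first.
  by rewrite -mulrA -[L _ / _]/(clen a b c) divfK.
rewrite z invr0 mulr0 !mul0r; have := nuc c cQ; rewrite z => /eqP.
rewrite psumr_eq0; last by move=> k _; exact: nu0.
by move=> /allP/(_ i); rewrite mem_index_enum /= => /(_ isT)/eqP.
Qed.

Lemma nnmeas_spread nu i j : disc_plan w a b Qs nu -> nnmeas (spread a b Qs nu i j).
Proof.
move=> [nu0 _]; apply: (@nnmeas_step (fun c => nu i c / clen a b c)) => c cQ.
by rewrite divr_ge0 ?nu0 // divr_ge0 // exprn_ge0.
Qed.

(** An inequality, since the total density is 0 instead of 1 on a cell of length 0. *)
Lemma spread_le1 nu j u : disc_plan w a b Qs nu -> 0 <= u < 1 ->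
  \sum_(i < n) spread a b Qs nu i j u <= 1.
Proof.
move=> [_ [_ nuc]] /(step_at j)[c [cQ _ _ E]].
under eq_bigr => i _ do rewrite -[spread _ _ _ _ _ _ _]/(step _ _ _) E.
rewrite -mulr_suml nuc //; have [->|nz] := eqVneq (clen a b c) 0.
  by rewrite mul0r.
by rewrite divff.
Qed.

(** * Comparison of true distances with distances to the chosen points *)

Let dst i j u := dist2 (p i) (sx a b j u).
Let stepd i := step (fun c => dist2 (p i) (sx a b (cseg c) (t c))).
Let tub r := tubes L (fun i j => proj_param (p i) (a j) (b j)) r.

Let nn_dst i j : nnmeas (dst i j).
Proof.
by split=> [|u _]; [exact: measurable_dist2_segpt|exact: dist2_ge0].
Qed.

Let nn_stepd i j : nnmeas (stepd i j).
Proof. by apply: nnmeas_step => c _; exact: dist2_ge0. Qed.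

(** Priced by the distance to the chosen points, a plan costs exactly as much as the discrete plan
    formed by its cell masses. *)
Lemma wcost_step (tau : 'I_n -> 'I_m -> R -> R) nu :
  (forall i j, nnmeas (tau i j)) ->
  (forall i c, c \in Qs -> mass (tau i) c = (nu i c)%:E) ->
  wcost L tau stepd = (disc_cost p a b Qs t nu)%:E.
Proof.
move=> ht hm; rewrite /wcost /disc_cost -sumEFin; apply: eq_bigr => i _.
rewrite (int_step (g := tau i)) // => [|c]; last exact: dist2_ge0.
by rewrite -sumEFin; apply: eq_big_seq => c cQ; rewrite hm // muleC.
Qed.

Lemma tub_ge1 r i j u : L j != 0 -> dst i j u <= r -> 1 <= tub r j u.
Proof.
by move=> Lj h; apply: (tubes_ge1 L0 (i := i)) => //; exact: le_trans (proj_param_le _ _ _ _) h.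
Qed.

(** A cell left for its ratios gives the factor [1 + delta] in both directions. In a cell close to
    [p k], the two points are within [2 (delta / N)] of each other, and the tube of [p k] contains
    [u], so that [e] covers this error. *)
Lemma step_vs_dst i j u : L j != 0 -> 0 <= u < 1 ->
  let e := 2 * (delta / N) * tub (delta / N) j u in
  stepd i j u <= (1 + delta) * dst i j u + e /\
  dst i j u <= (1 + delta) * stepd i j u + e.
Proof.
move=> Lj hu e; have r0 : 0 <= delta / N by rewrite divr_ge0 // ltW.
have d0 := ltW delta0.
have [c [cQ cj hc E]] := step_at j hu; rewrite /stepd E /dst cj.
set x := sx a b j u; set y := sx a b j (t c).
have e0 : 0 <= e by rewrite !mulr_ge0 // tubes_ge0.
have dx := dist2_ge0 (p i) x; have dy := dist2_ge0 (p i) y.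
have hx := in_cello_cell hc; have hy := tin cQ.
have [_ [/close_or_ratio ncl _]] : inQ p a b delta c by exact/Qin.
case: ncl => [[k hk]|rat]; last first.
  have := rat i _ _ hy hx; have := rat i _ _ hx hy; rewrite cj -/x -/y => h1 h2.
  by split; lra.
have kx := hk _ hx; have ky := hk _ hy; rewrite cj -/x -/y in kx ky.
have e1 : 2 * (delta / N) <= e.
  by rewrite ler_peMr ?mulr_ge0 //; exact: (tub_ge1 (i := k)).
have t1 := dist2_triangle (p k) x y; have t2 := dist2_triangle x (p i) y.
have t3 := dist2_triangle y (p i) x.
rewrite (dist2C x (p k)) in t1; rewrite (dist2C y x) in t3.
have := mulr_ge0 d0 dx; have := mulr_ge0 d0 dy.
by split; lra.
Qed.

(** With [r1 = 1 / (6 N)], integrating a pointwise bound by tubes gives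
    [2 r1 <= cost + r1 (2 r1 N) + r1 (4 r1 N)], and the last two terms add up to [r1] because
    [6 r1 N = 1]. *)
Lemma wcost_lower (tau : 'I_n -> 'I_m -> R -> R) :
  (forall i j, nnmeas (tau i j)) ->
  (forall j u, 0 <= u < 1 -> \sum_(i < n) tau i j u = 1) ->
  ((6 * N)^-1%:E <= wcost L tau dst)%E.
Proof.
move=> ht t1; set r1 : R := (6 * N)^-1; have r10 : 0 < r1 by rewrite invr_gt0 mulr_gt0.
have tl j u : 0 <= u < 1 -> \sum_(i < n) tau i j u <= 1 by move=> /t1 ->.
have nt r (i : 'I_n) j : nnmeas ((fun=> tub r) i j) by exact: nnmeas_tubes.
have ntt (i : 'I_n) j : nnmeas (fun u => r1 * tub r1 j u + r1 * tub (2 * r1) j u).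
  by apply: nnmeasD; apply: nnmeasM; by [exact/nnmeas_cst/ltW|exact: nt].
(* Both tubes count when the distance is at most [r1], the larger one still counts up to [2 * r1],
   and beyond that the distance alone suffices. *)
have : (wcost L tau (fun _ _ _ => 2 * r1)%R <= wcost L tau
    (fun i j u => 1 * dst i j u + 1 * (r1 * tub r1 j u + r1 * tub (2 * r1) j u))%R)%E.
  apply: le_wcost => //.
  - by move=> i j; apply: nnmeas_cst; rewrite mulr_ge0 // ltW.
  - by move=> i j; apply: nnmeasD; apply: nnmeasM;
      by [exact: nnmeas_cst|exact: nn_dst|exact: ntt].
  move=> i j u Lj hu; rewrite !mul1r.
  have d0 := dist2_ge0 (p i) (sx a b j u).
  have g1 := tubes_ge0 L (fun i j => proj_param (p i) (a j) (b j)) r1 j u.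
  have g2 := tubes_ge0 L (fun i j => proj_param (p i) (a j) (b j)) (2 * r1) j u.
  have [h1|h1] := leP (dst i j u) r1.
    have {}g1 := tub_ge1 Lj h1.
    have {}g2 : 1 <= tub (2 * r1) j u by apply: (tub_ge1 Lj (i := i)); lra.
    by rewrite /dst /tub in h1 g1 g2 *; nra.
  have [h2|h2] := leP (dst i j u) (2 * r1).
    have {}g2 := tub_ge1 Lj h2.
    by rewrite /dst /tub in h1 h2 g1 g2 *; nra.
  by rewrite /dst /tub in h1 h2 g1 g2 *; nra.
rewrite wcost_cst // ?L1 ?mulr1; last by rewrite mulr_ge0 // ltW.
rewrite wcostD // !mul1e wcostD; try by [|exact: ltW|exact: nt].
have c1 := wcost_tubes L0 (fun i j => proj_param (p i) (a j) (b j)) (ltW r10) ht tl.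
have c2 := wcost_tubes L0 (fun i j => proj_param (p i) (a j) (b j))
  (mulr_ge0 (ler0n _ 2) (ltW r10)) ht tl.
have r1e : (0 <= r1%:E)%E by rewrite lee_fin ltW.
move=> /le_trans h; have {}h := h _ (leeD (lexx _)
  (leeD (lee_wpmul2l r1e c1) (lee_wpmul2l r1e c2))).
rewrite -(@leeD2rE _ r1%:E) // -EFinD; apply: le_trans (le_trans h _).
  by rewrite lee_fin; lra.
rewrite leeD2l // -!EFinM -EFinD lee_fin le_eqVlt; apply/orP; left; apply/eqP.
rewrite /r1; move: (N) (lt0r_neq0 N0) => k k0; by field.
Qed.

(** The endpoint 1 is a null set. *)
Lemma plan_cost_wcost (tau : 'I_n -> 'I_m -> R -> R) :
  (forall i j, nnmeas (tau i j)) -> plan_cost p a b tau = wcost L tau dst.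
Proof.
move=> ht; apply: eq_bigr => i _; apply: eq_bigr => j _.
rewrite /I01 -integral_itv_bndo_bndc //.
have nn : nnmeas (fun u => tau i j u * dst i j u * L j).
  by apply: nnmeasMr => //; exact: nnmeasM.
by case: (nnmeas_EFin nn).
Qed.

(** With [r = delta / N], the error price [2 r] per tube costs at most
    [2 r (2 r N) = 4 delta^2 / N]. *)
Lemma wcost_le_add (tau f g : 'I_n -> 'I_m -> R -> R) :
  (forall i j, nnmeas (tau i j)) -> (forall i j, nnmeas (f i j)) ->
  (forall i j, nnmeas (g i j)) ->
  (forall j u, 0 <= u < 1 -> \sum_(i < n) tau i j u <= 1) ->
  (forall i j u, L j != 0 -> 0 <= u < 1 ->
    f i j u <= (1 + delta) * g i j u + 2 * (delta / N) * tub (delta / N) j u) ->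
  (wcost L tau f <= (1 + delta)%:E * wcost L tau g + (4 * delta ^+ 2 / N)%:E)%E.
Proof.
move=> ht hf hg t1 fg; have r0 : 0 <= delta / N by rewrite divr_ge0 // ltW.
have r20 : 0 <= 2 * (delta / N) by rewrite mulr_ge0.
have d0 : 0 <= 1 + delta by rewrite addr_ge0 // ltW.
have nt (i : 'I_n) j : nnmeas ((fun=> tub (delta / N)) i j) by exact: nnmeas_tubes.
apply: le_trans (le_wcost (g := fun i j u => (1 + delta) * g i j u
    + 2 * (delta / N) * tub (delta / N) j u) L0 ht hf _ fg) _.
  move=> i j; apply: nnmeasD; apply: nnmeasM; [|exact: hg| |exact: (nt i)].
    exact: nnmeas_cst.
  exact: nnmeas_cst.
rewrite (wcostD L0 d0 r20 ht hg nt); apply: leeD => //.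
have r2 : (0 <= (2 * (delta / N))%:E)%E by rewrite lee_fin.
apply: le_trans (lee_wpmul2l r2
  (wcost_tubes L0 (fun i j => proj_param (p i) (a j) (b j)) r0 ht t1)) _.
rewrite -EFinM lee_fin le_eqVlt; apply/orP; left; apply/eqP.
by move: (N) (lt0r_neq0 N0) => k k0; field.
Qed.

Lemma spread_cost_le nu (taus : 'I_n -> 'I_m -> R -> R) : delta <= 1 / 4 ->
  disc_optimal p w a b Qs t nu -> plan w a b taus ->
  (plan_cost p a b (spread a b Qs nu)
     <= (1 + 17 * delta)%:E * plan_cost p a b taus)%E.
Proof.
move=> delta4 [nuP nuopt] [mt [t01 [t1 tw]]].
have ht i j : nnmeas (taus i j).
  split; last first.
    by move=> u /andP[u0 /ltW u1]; have /andP[] : 0 <= taus i j u <= 1 by rewrite t01 // u0.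
  apply: measurable_funS (mt i j); first exact: measurable_itv.
  by apply: subset_itvl; rewrite bnd_simp.
have hs i j : nnmeas (spread a b Qs nu i j) by exact: nnmeas_spread nuP.
have t1' j u : 0 <= u < 1 -> \sum_(i < n) taus i j u = 1.
  by move=> /andP[u0 /ltW u1]; rewrite t1 // u0.
have tl j u : 0 <= u < 1 -> \sum_(i < n) taus i j u <= 1 by move=> /t1' ->.
have mass0 i c : (0 <= mass (taus i) c)%E by exact: mass_ge0.
(* The discretisation of [taus] by its cell masses, which are finite because each is at most the
   length of the cell. *)
pose nus i c := fine (mass (taus i) c).
have massE i c : c \in Qs -> mass (taus i) c = (nus i c)%:E.
  move=> cQ; rewrite fineK // ge0_fin_numE //.
  apply: (@le_lt_trans _ _ (clen a b c)%:E); last exact: ltry.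
  by rewrite -(sum_mass cQ ht t1') (bigD1 i) //= leeDl // sume_ge0.
have nusP : disc_plan w a b Qs nus.
  split=> [i c _|]; first exact: fine_ge0.
  split=> [i|c cQ]; apply: EFin_inj; rewrite -sumEFin; last first.
    by rewrite -(sum_mass cQ ht t1'); apply: eq_bigr => i _; rewrite massE.
  rewrite -tw; transitivity (\sum_(c <- Qs) mass (taus i) c)%E.
    by apply: eq_big_seq => c cQ; rewrite massE.
  rewrite mass_total //; apply: eq_bigr => j _.
  rewrite /I01 -integral_itv_bndo_bndc //.
  by case: (nnmeas_EFin (nnmeasMr (L0 j) (ht i j))).
(* Optimality of [nu] is used here, against this discretisation. *)
have cB := nuopt _ nusP.
have hB := wcost_step hs (fun i c cQ => mass_spread i cQ nuP).
have hBs := wcost_step ht massE.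
rewrite !plan_cost_wcost //.
have up := wcost_le_add hs nn_dst nn_stepd (fun j u hu => spread_le1 j nuP hu)
  (fun i j u Lj hu => proj2 (step_vs_dst i Lj hu)).
have lo := wcost_le_add ht nn_stepd nn_dst tl
  (fun i j u Lj hu => proj1 (step_vs_dst i Lj hu)).
have low := wcost_lower ht t1'.
rewrite hB in up; rewrite hBs in lo; move: up lo low.
have d0 := ltW delta0; have d17 : 0 < 1 + 17 * delta by rewrite ltr_wpDr // mulr_ge0.
(* An infinite cost of [taus] makes the claim trivial, and the lower bound excludes the value
   [-oo]. *)
case: (wcost L taus dst) => [C| |//]; last first.
  by move=> *; rewrite gt0_muley ?lte_fin // leey.
move=> /le_trans up lo low; apply: up.
rewrite -!EFinM -!EFinD !lee_fin in lo low *.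
set E := 4 * delta ^+ 2 / N in lo *.
have hE : E <= 24 * delta ^+ 2 * C.
  have -> : E = 24 * delta ^+ 2 * (6 * N)^-1 by rewrite /E; move: (N) (lt0r_neq0 N0) => k k0; field.
  by rewrite ler_wpM2l // mulr_ge0 // sqr_ge0.
have C0 : 0 <= C by apply: le_trans low; rewrite invr_ge0 mulr_ge0 // ltW.
have E0 : 0 <= E by rewrite mulr_ge0 ?invr_ge0 ?mulr_ge0 ?sqr_ge0 // ltW.
have h1 : (1 + delta) * disc_cost p a b Qs t nu
    <= (1 + delta) * ((1 + delta) * C + E).
  by apply: ler_wpM2l; [lra|exact: le_trans lo].
have h2 : (2 + delta) * E <= (2 + delta) * (24 * delta ^+ 2 * C).
  by apply: ler_wpM2l; [lra|].
have h3 : 0 <= (1 / 4 - delta) * (delta * C).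
  by rewrite mulr_ge0 ?subr_ge0 // mulr_ge0.
have h4 : 0 <= (1 / 4 - delta) * (delta ^+ 2 * C).
  by rewrite mulr_ge0 ?subr_ge0 // mulr_ge0 // sqr_ge0.
(* The bounds add up to [(1 + 2 delta + 49 delta^2 + 24 delta^3) C]. By [h4] the cubic term is at
   most [6 delta^2 C], and by [h3] then [55 delta^2 C <= (55/4) delta C]; finally
   [2 + 55/4 <= 17]. *)
nra.
Qed.

End Plans.

Unset Implicit Arguments.

(** The bound holds against every plan [tau_star], in particular against an optimal one. *)
Theorem theorem2 (R : realType) (n m : nat) (p : 'I_n -> pt2) (w : 'I_n -> R)
  (a b : 'I_m -> pt2) (delta : R) :
  (forall i, 0 < w i) ->
  \sum_(i < n) w i = 1 ->
  \sum_(j < m) seglen a b j = 1 ->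
  0 < delta -> delta <= 1 / 4 ->
  forall (Qs : seq (cell m)) (t : cell m -> R) (nu : 'I_n -> cell m -> R),
  uniq Qs ->
  (forall c, c \in Qs <-> inQ p a b delta c) ->
  (forall c, c \in Qs -> in_cell c (t c)) ->
  disc_optimal p w a b Qs t nu ->
  forall tau_star, plan w a b tau_star ->
  (plan_cost p a b (spread a b Qs nu)
     <= (1 + 17 * delta)%:E * plan_cost p a b tau_star)%E.
Proof.
move=> _ w1 L1 delta0 delta4 Qs t nu uQ Qin tin opt tau_star tauP.
have n0 : (0 < n)%N.
  by rewrite lt0n; apply/eqP => z; subst n; move: w1;
    rewrite big_ord0 => /esym/eqP; rewrite oner_eq0.
have m0 : (0 < m)%N.
  by rewrite lt0n; apply/eqP => z; subst m; move: L1;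
    rewrite big_ord0 => /esym/eqP; rewrite oner_eq0.
exact: (spread_cost_le n0 m0 delta0 L1 uQ Qin tin delta4 opt tauP).
Qed.
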